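(* Let $\mathsf{B}$ be a bicategory and let $\mathsf{D}$ be a displayed bicategory over $\mathsf{B}$, with total bicategory $\int\mathsf{D}$. Then: 1. $\int\mathsf{D}$ is locally univalent if $\mathsf{B}$ is locally univalent and $\mathsf{D}$ is (displayed) locally univalent; 2. $\int\mathsf{D}$ is globally univalent if $\mathsf{B}$ is globally univalent and $\mathsf{D}$ is (displayed) globally univalent.
   Context: We work in Martin-Löf type theory with function extensionality (univalent foundations). A bicategory $\mathsf{B}$ has a type $\mathsf{B}_0$ of objects, types $\mathsf{B}_1(a,b)$ of 1-cells $a\to b$, and sets $\mathsf{B}_2(f,g)$ of 2-cells $f\Rightarrow g$ (no truncation on objects or 1-cells), with identities, composition $f\cdot g$ of 1-cells (diagrammatic order), vertical composition $\bullet$, whiskerings $f\vartriangleleft\theta$ and $\theta\vartriangleright g$, invertible unitors $\lambda,\rho$ and associators $\alpha(f,g,h):f\cdot(g\cdot h)\Rightarrow(f\cdot g)\cdot h$, satisfying the usual axioms. An invertible 2-cell is a 2-cell with a two-sided inverse for $\bullet$; $\mathsf{inv2cell}(f,g)$ is the type of these. An adjoint equivalence $a\simeq b$ is a 1-cell $f:a\to b$ with $r:b\to a$ and invertible 2-cells $\eta:\mathrm{id}_1(a)\Rightarrow f\cdot r$, $\varepsilon:r\cdot f\Rightarrow\mathrm{id}_1(b)$ satisfying the two triangle identities. $\mathsf{B}$ is locally univalent if all canonical maps $\mathsf{idtoiso}^{2,1}_{f,g}:(f=g)\to\mathsf{inv2cell}(f,g)$ (sending $\mathsf{refl}$ to $\mathrm{id}_2$)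 are equivalences; globally univalent if all canonical maps $\mathsf{idtoiso}^{2,0}_{a,b}:(a=b)\to(a\simeq b)$ (sending $\mathsf{refl}$ to $\mathrm{id}_1$) are equivalences. A displayed bicategory $\mathsf{D}$ over $\mathsf{B}$ consists of: for each $a:\mathsf{B}_0$ a type $\mathsf{D}_a$ of displayed objects; for each $f:a\to b$, $\bar a:\mathsf{D}_a$, $\bar b:\mathsf{D}_b$ a type $\bar a\xrightarrow{f}\bar b$ of displayed 1-cells; for each $\theta:f\Rightarrow g$, $\bar f:\bar a\xrightarrow{f}\bar b$, $\bar g:\bar a\xrightarrow{g}\bar b$ a set $\bar f\xRightarrow{\theta}\bar g$ of displayed 2-cells; together with displayed versions of every bicategory operation (identities, compositions, whiskerings, unitors, associators and their inverses), each lying over the corresponding operation of $\mathsf{B}$, and displayed versions of every bicategory axiom, each holding as a dependent equality over the corresponding axiom of $\mathsf{B}$. The total bicategory $\int\mathsf{D}$ has as objects, 1-cells and 2-cells pairs $(a,\bar a)$, $(f,\bar f)$, $(\theta,\bar\theta)$, with componentwise operations. A displayed 2-cell $\bar\theta:\bar f\xRightarrow{\theta}\bar g$ over an invertible 2-cell $\theta$ is invertible if it has a displayed 2-cell over $\theta^{-1}$ that is a two-sided inverse (modulo transport along the inverse laws of $\theta$); write $\bar f\cong_\theta\bar g$ for the type of displayed invertible 2-cells over $\theta$. Given an adjoint equivalence $f:a\simeq b$ with right adjoint $r$, unit $\eta$, counit $\varepsilon$, a displayed adjoint equivalence over it from $\bar a$ to $\bar b$ is a displayed 1-cell $\bar f:\bar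 a\xrightarrow{f}\bar b$ with a displayed 1-cell $\bar r:\bar b\xrightarrow{r}\bar a$ and displayed invertible 2-cells $\mathrm{id}_1(\bar a)\xRightarrow{\eta}\bar f\cdot\bar r$ and $\bar r\cdot\bar f\xRightarrow{\varepsilon}\mathrm{id}_1(\bar b)$ satisfying displayed triangle identities over those of $f$; write $\bar a\simeq_f\bar b$ for the type of these. $\mathsf{D}$ is locally univalent if for all $p:f=g$, $\bar f$ over $f$, $\bar g$ over $g$ (with the same displayed endpoints) the map $(\bar f=_p\bar g)\to(\bar f\cong_{\mathsf{idtoiso}^{2,1}(p)}\bar g)$, defined by path induction and sending $\mathsf{refl}$ to the identity, is an equivalence. $\mathsf{D}$ is globally univalent if for all $p:a=b$, $\bar a:\mathsf{D}_a$, $\bar b:\mathsf{D}_b$ the map $(\bar a=_p\bar b)\to(\bar a\simeq_{\mathsf{idtoiso}^{2,0}(p)}\bar b)$, sending $\mathsf{refl}$ to the identity, is an equivalence. Here $=_p$ denotes dependent equality over $p$. *)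

(* Defs.v *)
From Stdlib Require Import HLevels.

Set Implicit Arguments.
Unset Strict Implicit.

(** Equality [=] plays the role of the identity type.  Although it lives in
    [Prop], it eliminates into [Type] and is used proof-relevantly: neither
    proof irrelevance nor UIP is assumed.  Contractibility is valued in [Type],
    so that an equivalence carries an inverse and not merely its existence. *)

Definition is_contr (X : Type) : Type := {c : X & forall x : X, x = c}.

Definition is_equiv (X Y : Type) (f : X -> Y) : Type :=
  forall y : Y, is_contr {x : X & f x = y}.

Definition path_over (X : Type) (P : X -> Type) (x y : X) (p : x = y)
  (u : P x) (v : P y) : Prop :=
  eq_rect x P u y p = v.

Record bicat_data : Type := {
  ob :> Type;
  hom : ob -> ob -> Type;
  cell : forall a b : ob, hom a b -> hom a b -> Type;
  id1 : forall a : ob, hom a a;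
  comp : forall a b c : ob, hom a b -> hom b c -> hom a c;
  id2 : forall (a b : ob) (f : hom a b), cell f f;
  vcomp : forall (a b : ob) (f g h : hom a b),
    cell f g -> cell g h -> cell f h;
  lwhisker : forall (a b c : ob) (f : hom a b) (g h : hom b c),
    cell g h -> cell (comp f g) (comp f h);
  rwhisker : forall (a b c : ob) (f g : hom a b) (h : hom b c),
    cell f g -> cell (comp f h) (comp g h);
  lunitor : forall (a b : ob) (f : hom a b), cell (comp (id1 a) f) f;
  linvunitor : forall (a b : ob) (f : hom a b), cell f (comp (id1 a) f);
  runitor : forall (a b : ob) (f : hom a b), cell (comp f (id1 b)) f;
  rinvunitor : forall (a b : ob) (f : hom a b), cell f (comp f (id1 b));
  lassociator : forall (a b c d : ob) (f : hom a b) (g : hom b c) (h : hom c d),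
    cell (comp f (comp g h)) (comp (comp f g) h);
  rassociator : forall (a b c d : ob) (f : hom a b) (g : hom b c) (h : hom c d),
    cell (comp (comp f g) h) (comp f (comp g h))
}.

Arguments lwhisker {_ _ _ _} f {_ _} _.
Arguments rwhisker {_ _ _ _ _ _} h _.

Declare Scope bicat_scope.
Open Scope bicat_scope.

Notation "a --> b" := (hom a b) (at level 55, right associativity) : bicat_scope.
Notation "f ==> g" := (cell f g) (at level 60, no associativity) : bicat_scope.
Notation "f · g" := (comp f g) (at level 40, left associativity) : bicat_scope.
Notation "x • y" := (vcomp x y) (at level 50, left associativity) : bicat_scope.
Notation "f ◃ x" := (lwhisker f x) (at level 45, no associativity) : bicat_scope.
Notation "x ▹ h" := (rwhisker h x) (at level 45, no associativity) : bicat_scope.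

Record bicat : Type := {
  bicat_data_of :> bicat_data;
  cell_hset : forall (a b : bicat_data_of) (f g : a --> b), IsHSet (f ==> g);
  id2_left : forall (a b : bicat_data_of) (f g : a --> b) (x : f ==> g),
    id2 f • x = x;
  id2_right : forall (a b : bicat_data_of) (f g : a --> b) (x : f ==> g),
    x • id2 g = x;
  vassocr : forall (a b : bicat_data_of) (f g h k : a --> b)
      (x : f ==> g) (y : g ==> h) (z : h ==> k),
    x • (y • z) = (x • y) • z;
  lwhisker_id2 : forall (a b c : bicat_data_of) (f : a --> b) (g : b --> c),
    f ◃ id2 g = id2 (f · g);
  id2_rwhisker : forall (a b c : bicat_data_of) (f : a --> b) (g : b --> c),
    id2 f ▹ g = id2 (f · g);
  lwhisker_vcomp : forall (a b c : bicat_data_of) (f : a --> b)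
      (g h i : b --> c) (x : g ==> h) (y : h ==> i),
    (f ◃ x) • (f ◃ y) = f ◃ (x • y);
  rwhisker_vcomp : forall (a b c : bicat_data_of) (f g h : a --> b)
      (i : b --> c) (x : f ==> g) (y : g ==> h),
    (x ▹ i) • (y ▹ i) = (x • y) ▹ i;
  vcomp_lunitor : forall (a b : bicat_data_of) (f g : a --> b) (x : f ==> g),
    (id1 a ◃ x) • lunitor g = lunitor f • x;
  vcomp_runitor : forall (a b : bicat_data_of) (f g : a --> b) (x : f ==> g),
    (x ▹ id1 b) • runitor g = runitor f • x;
  lwhisker_lwhisker : forall (a b c d : bicat_data_of) (f : a --> b)
      (g : b --> c) (h i : c --> d) (x : h ==> i),
    (f ◃ (g ◃ x)) • lassociator f g i = lassociator f g h • ((f · g) ◃ x);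
  rwhisker_lwhisker : forall (a b c d : bicat_data_of) (f : a --> b)
      (g h : b --> c) (i : c --> d) (x : g ==> h),
    (f ◃ (x ▹ i)) • lassociator f h i = lassociator f g i • ((f ◃ x) ▹ i);
  rwhisker_rwhisker : forall (a b c d : bicat_data_of) (f g : a --> b)
      (h : b --> c) (i : c --> d) (x : f ==> g),
    lassociator f h i • ((x ▹ h) ▹ i) = (x ▹ (h · i)) • lassociator g h i;
  vcomp_whisker : forall (a b c : bicat_data_of) (f g : a --> b)
      (h i : b --> c) (x : f ==> g) (y : h ==> i),
    (x ▹ h) • (g ◃ y) = (f ◃ y) • (x ▹ i);
  lunitor_linvunitor : forall (a b : bicat_data_of) (f : a --> b),
    lunitor f • linvunitor f = id2 (id1 a · f);
  linvunitor_lunitor : forall (a b : bicat_data_of) (f : a --> b),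
    linvunitor f • lunitor f = id2 f;
  runitor_rinvunitor : forall (a b : bicat_data_of) (f : a --> b),
    runitor f • rinvunitor f = id2 (f · id1 b);
  rinvunitor_runitor : forall (a b : bicat_data_of) (f : a --> b),
    rinvunitor f • runitor f = id2 f;
  lassociator_rassociator : forall (a b c d : bicat_data_of)
      (f : a --> b) (g : b --> c) (h : c --> d),
    lassociator f g h • rassociator f g h = id2 (f · (g · h));
  rassociator_lassociator : forall (a b c d : bicat_data_of)
      (f : a --> b) (g : b --> c) (h : c --> d),
    rassociator f g h • lassociator f g h = id2 ((f · g) · h);
  runitor_rwhisker : forall (a b c : bicat_data_of) (f : a --> b) (g : b --> c),
    lassociator f (id1 b) g • (runitor f ▹ g) = f ◃ lunitor g;
  lassociator_lassociator : forall (a b c d e : bicat_data_of)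
      (f : a --> b) (g : b --> c) (h : c --> d) (i : d --> e),
    (f ◃ lassociator g h i) • lassociator f (g · h) i • (lassociator f g h ▹ i)
    = lassociator f g (h · i) • lassociator (f · g) h i
}.

Section UnitorCoherence.
Variable B : bicat.

Lemma lwhisker_id1_inj (a b : B) (f g : a --> b) (x y : f ==> g) :
  id1 a ◃ x = id1 a ◃ y -> x = y.
Proof.
  intro H.
  rewrite <- (id2_left x), <- (id2_left y), <- (linvunitor_lunitor f).
  rewrite <- !vassocr, <- !vcomp_lunitor, H. reflexivity.
Qed.

Lemma rwhisker_id1_inj (a b : B) (f g : a --> b) (x y : f ==> g) :
  x ▹ id1 b = y ▹ id1 b -> x = y.
Proof.
  intro H.
  rewrite <- (id2_left x), <- (id2_left y), <- (rinvunitor_runitor f).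
  rewrite <- !vassocr, <- !vcomp_runitor, H. reflexivity.
Qed.

Lemma lassociator_cancel_r (a b c d : B) (f : a --> b) (g : b --> c)
  (h : c --> d) (k : a --> d) (x y : k ==> f · (g · h)) :
  x • lassociator f g h = y • lassociator f g h -> x = y.
Proof.
  intro H.
  rewrite <- (id2_right x), <- (id2_right y), <- (lassociator_rassociator f g h).
  rewrite !vassocr, H. reflexivity.
Qed.

Lemma lassociator_cancel_l (a b c d : B) (f : a --> b) (g : b --> c)
  (h : c --> d) (k : a --> d) (x y : (f · g) · h ==> k) :
  lassociator f g h • x = lassociator f g h • y -> x = y.
Proof.
  intro H.
  rewrite <- (id2_left x), <- (id2_left y), <- (rassociator_lassociator f g h).
  rewrite <- !vassocr, H. reflexivity.
Qed.

Lemma lunitor_triangle (a b c : B) (f : a --> b) (g : b --> c) :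
  lassociator (id1 a) f g • (lunitor f ▹ g) = lunitor (f · g).
Proof.
  apply lwhisker_id1_inj.
  apply lassociator_cancel_r.
  rewrite <- lwhisker_vcomp, <- vassocr, rwhisker_lwhisker.
  rewrite <- (runitor_rwhisker (id1 a) f), <- rwhisker_vcomp.
  rewrite !vassocr, lassociator_lassociator.
  rewrite <- vassocr, rwhisker_rwhisker, vassocr, runitor_rwhisker.
  reflexivity.
Qed.

Lemma lunitor_runitor_id1 (a : B) : lunitor (id1 a) = runitor (id1 a).
Proof.
  apply rwhisker_id1_inj.
  apply lassociator_cancel_l.
  rewrite lunitor_triangle, runitor_rwhisker.
  rewrite <- (id2_right (lunitor _)), <- (id2_right (_ ◃ _)).
  rewrite <- (lunitor_linvunitor (id1 a)), !vassocr.
  rewrite vcomp_lunitor. reflexivity.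
Qed.

End UnitorCoherence.

Record inv2cell (B : bicat) (a b : B) (f g : a --> b) : Type := {
  inv2cell_cell :> f ==> g;
  inv2cell_inv : g ==> f;
  inv2cell_rinv : inv2cell_cell • inv2cell_inv = id2 f;
  inv2cell_linv : inv2cell_inv • inv2cell_cell = id2 g
}.

Definition id2_inv2cell (B : bicat) (a b : B) (f : a --> b) : inv2cell f f :=
  {| inv2cell_cell := id2 f;
     inv2cell_inv := id2 f;
     inv2cell_rinv := id2_left (id2 f);
     inv2cell_linv := id2_left (id2 f) |}.

Definition lunitor_inv2cell (B : bicat) (a b : B) (f : a --> b) :
  inv2cell (id1 a · f) f :=
  {| inv2cell_cell := lunitor f;
     inv2cell_inv := linvunitor f;
     inv2cell_rinv := lunitor_linvunitor f;
     inv2cell_linv := linvunitor_lunitor f |}.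

Definition linvunitor_inv2cell (B : bicat) (a b : B) (f : a --> b) :
  inv2cell f (id1 a · f) :=
  {| inv2cell_cell := linvunitor f;
     inv2cell_inv := lunitor f;
     inv2cell_rinv := linvunitor_lunitor f;
     inv2cell_linv := lunitor_linvunitor f |}.

Record adj_equiv (B : bicat) (a b : B) : Type := {
  adj_equiv_hom :> a --> b;
  adj_equiv_radj : b --> a;
  adj_equiv_unit : inv2cell (id1 a) (adj_equiv_hom · adj_equiv_radj);
  adj_equiv_counit : inv2cell (adj_equiv_radj · adj_equiv_hom) (id1 b);
  adj_equiv_triangle1 :
    linvunitor adj_equiv_hom
    • (adj_equiv_unit ▹ adj_equiv_hom)
    • rassociator adj_equiv_hom adj_equiv_radj adj_equiv_hom
    • (adj_equiv_hom ◃ adj_equiv_counit)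
    • runitor adj_equiv_hom
    = id2 adj_equiv_hom;
  adj_equiv_triangle2 :
    rinvunitor adj_equiv_radj
    • (adj_equiv_radj ◃ adj_equiv_unit)
    • lassociator adj_equiv_radj adj_equiv_hom adj_equiv_radj
    • (adj_equiv_counit ▹ adj_equiv_radj)
    • lunitor adj_equiv_radj
    = id2 adj_equiv_radj
}.

Lemma id1_triangle1 (B : bicat) (a : B) :
  linvunitor (id1 a)
  • (linvunitor (id1 a) ▹ id1 a)
  • rassociator (id1 a) (id1 a) (id1 a)
  • (id1 a ◃ lunitor (id1 a))
  • runitor (id1 a)
  = id2 (id1 a).
Proof.
  rewrite <- runitor_rwhisker, <- lunitor_runitor_id1.
  rewrite !vassocr.
  rewrite <- (vassocr _ (rassociator _ _ _) (lassociator _ _ _)).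
  rewrite rassociator_lassociator, id2_right.
  rewrite <- (vassocr _ (linvunitor _ ▹ _) (lunitor _ ▹ _)).
  rewrite rwhisker_vcomp, linvunitor_lunitor, id2_rwhisker, id2_right.
  apply linvunitor_lunitor.
Qed.

Lemma id1_triangle2 (B : bicat) (a : B) :
  rinvunitor (id1 a)
  • (id1 a ◃ linvunitor (id1 a))
  • lassociator (id1 a) (id1 a) (id1 a)
  • (lunitor (id1 a) ▹ id1 a)
  • lunitor (id1 a)
  = id2 (id1 a).
Proof.
  rewrite lunitor_runitor_id1.
  rewrite <- (vassocr _ (lassociator _ _ _) (runitor _ ▹ _)).
  rewrite runitor_rwhisker, <- (vassocr _ (_ ◃ _) (_ ◃ _)).
  rewrite lwhisker_vcomp, linvunitor_lunitor, lwhisker_id2, id2_right.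
  apply rinvunitor_runitor.
Qed.

Definition id1_adj_equiv (B : bicat) (a : B) : adj_equiv a a :=
  {| adj_equiv_hom := id1 a;
     adj_equiv_radj := id1 a;
     adj_equiv_unit := linvunitor_inv2cell (id1 a);
     adj_equiv_counit := lunitor_inv2cell (id1 a);
     adj_equiv_triangle1 := id1_triangle1 a;
     adj_equiv_triangle2 := id1_triangle2 a |}.

Definition idtoiso_2_1 (B : bicat) (a b : B) (f g : a --> b) (p : f = g) :
  inv2cell f g :=
  match p with eq_refl => id2_inv2cell f end.

Definition idtoiso_2_0 (B : bicat) (a b : B) (p : a = b) : adj_equiv a b :=
  match p with eq_refl => id1_adj_equiv a end.

Definition locally_univalent (B : bicat) : Type :=
  forall (a b : B) (f g : a --> b), is_equiv (@idtoiso_2_1 B a b f g).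

Definition globally_univalent (B : bicat) : Type :=
  forall a b : B, is_equiv (@idtoiso_2_0 B a b).

Record disp_bicat_data (B : bicat) : Type := {
  dob :> B -> Type;
  dhom : forall a b : B, a --> b -> dob a -> dob b -> Type;
  dcell : forall (a b : B) (f g : a --> b) (x : f ==> g)
      (aa : dob a) (bb : dob b),
    dhom f aa bb -> dhom g aa bb -> Type;
  did1 : forall (a : B) (aa : dob a), dhom (id1 a) aa aa;
  dcomp : forall (a b c : B) (f : a --> b) (g : b --> c)
      (aa : dob a) (bb : dob b) (cc : dob c),
    dhom f aa bb -> dhom g bb cc -> dhom (f · g) aa cc;
  did2 : forall (a b : B) (f : a --> b) (aa : dob a) (bb : dob b)
      (ff : dhom f aa bb),
    dcell (id2 f) ff ff;
  dvcomp : forall (a b : B) (f g h : a --> b) (x : f ==> g) (y : g ==> h)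
      (aa : dob a) (bb : dob b)
      (ff : dhom f aa bb) (gg : dhom g aa bb) (hh : dhom h aa bb),
    dcell x ff gg -> dcell y gg hh -> dcell (x • y) ff hh;
  dlwhisker : forall (a b c : B) (f : a --> b) (g h : b --> c) (x : g ==> h)
      (aa : dob a) (bb : dob b) (cc : dob c)
      (ff : dhom f aa bb) (gg : dhom g bb cc) (hh : dhom h bb cc),
    dcell x gg hh -> dcell (f ◃ x) (dcomp ff gg) (dcomp ff hh);
  drwhisker : forall (a b c : B) (f g : a --> b) (h : b --> c) (x : f ==> g)
      (aa : dob a) (bb : dob b) (cc : dob c)
      (ff : dhom f aa bb) (gg : dhom g aa bb) (hh : dhom h bb cc),
    dcell x ff gg -> dcell (x ▹ h) (dcomp ff hh) (dcomp gg hh);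
  dlunitor : forall (a b : B) (f : a --> b) (aa : dob a) (bb : dob b)
      (ff : dhom f aa bb),
    dcell (lunitor f) (dcomp (did1 aa) ff) ff;
  dlinvunitor : forall (a b : B) (f : a --> b) (aa : dob a) (bb : dob b)
      (ff : dhom f aa bb),
    dcell (linvunitor f) ff (dcomp (did1 aa) ff);
  drunitor : forall (a b : B) (f : a --> b) (aa : dob a) (bb : dob b)
      (ff : dhom f aa bb),
    dcell (runitor f) (dcomp ff (did1 bb)) ff;
  drinvunitor : forall (a b : B) (f : a --> b) (aa : dob a) (bb : dob b)
      (ff : dhom f aa bb),
    dcell (rinvunitor f) ff (dcomp ff (did1 bb));
  dlassociator : forall (a b c d : B) (f : a --> b) (g : b --> c) (h : c --> d)
      (aa : dob a) (bb : dob b) (cc : dob c) (dd : dob d)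
      (ff : dhom f aa bb) (gg : dhom g bb cc) (hh : dhom h cc dd),
    dcell (lassociator f g h)
      (dcomp ff (dcomp gg hh)) (dcomp (dcomp ff gg) hh);
  drassociator : forall (a b c d : B) (f : a --> b) (g : b --> c) (h : c --> d)
      (aa : dob a) (bb : dob b) (cc : dob c) (dd : dob d)
      (ff : dhom f aa bb) (gg : dhom g bb cc) (hh : dhom h cc dd),
    dcell (rassociator f g h)
      (dcomp (dcomp ff gg) hh) (dcomp ff (dcomp gg hh))
}.

Arguments dlwhisker {_ _ _ _ _ _ _ _ _ _ _ _} ff {_ _} _.
Arguments drwhisker {_ _ _ _ _ _ _ _ _ _ _ _ _ _} hh _.

Notation "aa -->[ f ] bb" := (dhom f aa bb)
  (at level 55, f at level 55, right associativity) : bicat_scope.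
Notation "ff ==>[ x ] gg" := (dcell x ff gg)
  (at level 60, x at level 60, no associativity) : bicat_scope.
Notation "ff ;; gg" := (dcomp ff gg)
  (at level 40, left associativity) : bicat_scope.
Notation "xx •• yy" := (dvcomp xx yy)
  (at level 50, left associativity) : bicat_scope.
Notation "ff ◃◃ xx" := (dlwhisker ff xx)
  (at level 45, no associativity) : bicat_scope.
Notation "xx ▹▹ hh" := (drwhisker hh xx)
  (at level 45, no associativity) : bicat_scope.

Definition dcell_over (B : bicat) (D : disp_bicat_data B) (a b : B)
  (f g : a --> b) (aa : D a) (bb : D b) (ff : aa -->[f] bb) (gg : aa -->[g] bb)
  (x y : f ==> g) (p : x = y) (xx : ff ==>[x] gg) (yy : ff ==>[y] gg) : Prop :=
  path_over (P := fun z : f ==> g => ff ==>[z] gg) p xx yy.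

Notation "xx =2[ p ] yy" := (dcell_over p xx yy)
  (at level 70, p at level 70, no associativity) : bicat_scope.

Record disp_bicat (B : bicat) : Type := {
  disp_bicat_data_of :> disp_bicat_data B;
  dcell_hset : forall (a b : B) (f g : a --> b) (x : f ==> g)
      (aa : disp_bicat_data_of a) (bb : disp_bicat_data_of b)
      (ff : aa -->[f] bb) (gg : aa -->[g] bb),
    IsHSet (ff ==>[x] gg);
  did2_left : forall (a b : B) (f g : a --> b) (x : f ==> g)
      (aa : disp_bicat_data_of a) (bb : disp_bicat_data_of b)
      (ff : aa -->[f] bb) (gg : aa -->[g] bb) (xx : ff ==>[x] gg),
    did2 ff •• xx =2[ id2_left x ] xx;
  did2_right : forall (a b : B) (f g : a --> b) (x : f ==> g)
      (aa : disp_bicat_data_of a) (bb : disp_bicat_data_of b)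
      (ff : aa -->[f] bb) (gg : aa -->[g] bb) (xx : ff ==>[x] gg),
    xx •• did2 gg =2[ id2_right x ] xx;
  dvassocr : forall (a b : B) (f g h k : a --> b)
      (x : f ==> g) (y : g ==> h) (z : h ==> k)
      (aa : disp_bicat_data_of a) (bb : disp_bicat_data_of b)
      (ff : aa -->[f] bb) (gg : aa -->[g] bb)
      (hh : aa -->[h] bb) (kk : aa -->[k] bb)
      (xx : ff ==>[x] gg) (yy : gg ==>[y] hh) (zz : hh ==>[z] kk),
    xx •• (yy •• zz) =2[ vassocr x y z ] (xx •• yy) •• zz;
  dlwhisker_id2 : forall (a b c : B) (f : a --> b) (g : b --> c)
      (aa : disp_bicat_data_of a) (bb : disp_bicat_data_of b)
      (cc : disp_bicat_data_of c)
      (ff : aa -->[f] bb) (gg : bb -->[g] cc),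
    ff ◃◃ did2 gg =2[ lwhisker_id2 f g ] did2 (ff ;; gg);
  did2_rwhisker : forall (a b c : B) (f : a --> b) (g : b --> c)
      (aa : disp_bicat_data_of a) (bb : disp_bicat_data_of b)
      (cc : disp_bicat_data_of c)
      (ff : aa -->[f] bb) (gg : bb -->[g] cc),
    did2 ff ▹▹ gg =2[ id2_rwhisker f g ] did2 (ff ;; gg);
  dlwhisker_vcomp : forall (a b c : B) (f : a --> b) (g h i : b --> c)
      (x : g ==> h) (y : h ==> i)
      (aa : disp_bicat_data_of a) (bb : disp_bicat_data_of b)
      (cc : disp_bicat_data_of c)
      (ff : aa -->[f] bb) (gg : bb -->[g] cc)
      (hh : bb -->[h] cc) (ii : bb -->[i] cc)
      (xx : gg ==>[x] hh) (yy : hh ==>[y] ii),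
    (ff ◃◃ xx) •• (ff ◃◃ yy) =2[ lwhisker_vcomp f x y ] ff ◃◃ (xx •• yy);
  drwhisker_vcomp : forall (a b c : B) (f g h : a --> b) (i : b --> c)
      (x : f ==> g) (y : g ==> h)
      (aa : disp_bicat_data_of a) (bb : disp_bicat_data_of b)
      (cc : disp_bicat_data_of c)
      (ff : aa -->[f] bb) (gg : aa -->[g] bb)
      (hh : aa -->[h] bb) (ii : bb -->[i] cc)
      (xx : ff ==>[x] gg) (yy : gg ==>[y] hh),
    (xx ▹▹ ii) •• (yy ▹▹ ii) =2[ rwhisker_vcomp i x y ] (xx •• yy) ▹▹ ii;
  dvcomp_lunitor : forall (a b : B) (f g : a --> b) (x : f ==> g)
      (aa : disp_bicat_data_of a) (bb : disp_bicat_data_of b)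
      (ff : aa -->[f] bb) (gg : aa -->[g] bb) (xx : ff ==>[x] gg),
    (did1 aa ◃◃ xx) •• dlunitor gg =2[ vcomp_lunitor x ] dlunitor ff •• xx;
  dvcomp_runitor : forall (a b : B) (f g : a --> b) (x : f ==> g)
      (aa : disp_bicat_data_of a) (bb : disp_bicat_data_of b)
      (ff : aa -->[f] bb) (gg : aa -->[g] bb) (xx : ff ==>[x] gg),
    (xx ▹▹ did1 bb) •• drunitor gg =2[ vcomp_runitor x ] drunitor ff •• xx;
  dlwhisker_lwhisker : forall (a b c d : B) (f : a --> b) (g : b --> c)
      (h i : c --> d) (x : h ==> i)
      (aa : disp_bicat_data_of a) (bb : disp_bicat_data_of b)
      (cc : disp_bicat_data_of c) (dd : disp_bicat_data_of d)
      (ff : aa -->[f] bb) (gg : bb -->[g] cc)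
      (hh : cc -->[h] dd) (ii : cc -->[i] dd) (xx : hh ==>[x] ii),
    (ff ◃◃ (gg ◃◃ xx)) •• dlassociator ff gg ii
    =2[ lwhisker_lwhisker f g x ]
    dlassociator ff gg hh •• ((ff ;; gg) ◃◃ xx);
  drwhisker_lwhisker : forall (a b c d : B) (f : a --> b) (g h : b --> c)
      (i : c --> d) (x : g ==> h)
      (aa : disp_bicat_data_of a) (bb : disp_bicat_data_of b)
      (cc : disp_bicat_data_of c) (dd : disp_bicat_data_of d)
      (ff : aa -->[f] bb) (gg : bb -->[g] cc)
      (hh : bb -->[h] cc) (ii : cc -->[i] dd) (xx : gg ==>[x] hh),
    (ff ◃◃ (xx ▹▹ ii)) •• dlassociator ff hh ii
    =2[ rwhisker_lwhisker f i x ]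
    dlassociator ff gg ii •• ((ff ◃◃ xx) ▹▹ ii);
  drwhisker_rwhisker : forall (a b c d : B) (f g : a --> b) (h : b --> c)
      (i : c --> d) (x : f ==> g)
      (aa : disp_bicat_data_of a) (bb : disp_bicat_data_of b)
      (cc : disp_bicat_data_of c) (dd : disp_bicat_data_of d)
      (ff : aa -->[f] bb) (gg : aa -->[g] bb)
      (hh : bb -->[h] cc) (ii : cc -->[i] dd) (xx : ff ==>[x] gg),
    dlassociator ff hh ii •• ((xx ▹▹ hh) ▹▹ ii)
    =2[ rwhisker_rwhisker h i x ]
    (xx ▹▹ (hh ;; ii)) •• dlassociator gg hh ii;
  dvcomp_whisker : forall (a b c : B) (f g : a --> b) (h i : b --> c)
      (x : f ==> g) (y : h ==> i)
      (aa : disp_bicat_data_of a) (bb : disp_bicat_data_of b)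
      (cc : disp_bicat_data_of c)
      (ff : aa -->[f] bb) (gg : aa -->[g] bb)
      (hh : bb -->[h] cc) (ii : bb -->[i] cc)
      (xx : ff ==>[x] gg) (yy : hh ==>[y] ii),
    (xx ▹▹ hh) •• (gg ◃◃ yy) =2[ vcomp_whisker x y ] (ff ◃◃ yy) •• (xx ▹▹ ii);
  dlunitor_linvunitor : forall (a b : B) (f : a --> b)
      (aa : disp_bicat_data_of a) (bb : disp_bicat_data_of b)
      (ff : aa -->[f] bb),
    dlunitor ff •• dlinvunitor ff
    =2[ lunitor_linvunitor f ] did2 (did1 aa ;; ff);
  dlinvunitor_lunitor : forall (a b : B) (f : a --> b)
      (aa : disp_bicat_data_of a) (bb : disp_bicat_data_of b)
      (ff : aa -->[f] bb),
    dlinvunitor ff •• dlunitor ff =2[ linvunitor_lunitor f ] did2 ff;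
  drunitor_rinvunitor : forall (a b : B) (f : a --> b)
      (aa : disp_bicat_data_of a) (bb : disp_bicat_data_of b)
      (ff : aa -->[f] bb),
    drunitor ff •• drinvunitor ff
    =2[ runitor_rinvunitor f ] did2 (ff ;; did1 bb);
  drinvunitor_runitor : forall (a b : B) (f : a --> b)
      (aa : disp_bicat_data_of a) (bb : disp_bicat_data_of b)
      (ff : aa -->[f] bb),
    drinvunitor ff •• drunitor ff =2[ rinvunitor_runitor f ] did2 ff;
  dlassociator_rassociator : forall (a b c d : B)
      (f : a --> b) (g : b --> c) (h : c --> d)
      (aa : disp_bicat_data_of a) (bb : disp_bicat_data_of b)
      (cc : disp_bicat_data_of c) (dd : disp_bicat_data_of d)
      (ff : aa -->[f] bb) (gg : bb -->[g] cc) (hh : cc -->[h] dd),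
    dlassociator ff gg hh •• drassociator ff gg hh
    =2[ lassociator_rassociator f g h ] did2 (ff ;; (gg ;; hh));
  drassociator_lassociator : forall (a b c d : B)
      (f : a --> b) (g : b --> c) (h : c --> d)
      (aa : disp_bicat_data_of a) (bb : disp_bicat_data_of b)
      (cc : disp_bicat_data_of c) (dd : disp_bicat_data_of d)
      (ff : aa -->[f] bb) (gg : bb -->[g] cc) (hh : cc -->[h] dd),
    drassociator ff gg hh •• dlassociator ff gg hh
    =2[ rassociator_lassociator f g h ] did2 ((ff ;; gg) ;; hh);
  drunitor_rwhisker : forall (a b c : B) (f : a --> b) (g : b --> c)
      (aa : disp_bicat_data_of a) (bb : disp_bicat_data_of b)
      (cc : disp_bicat_data_of c)
      (ff : aa -->[f] bb) (gg : bb -->[g] cc),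
    dlassociator ff (did1 bb) gg •• (drunitor ff ▹▹ gg)
    =2[ runitor_rwhisker f g ] ff ◃◃ dlunitor gg;
  dlassociator_lassociator : forall (a b c d e : B)
      (f : a --> b) (g : b --> c) (h : c --> d) (i : d --> e)
      (aa : disp_bicat_data_of a) (bb : disp_bicat_data_of b)
      (cc : disp_bicat_data_of c) (dd : disp_bicat_data_of d)
      (ee : disp_bicat_data_of e)
      (ff : aa -->[f] bb) (gg : bb -->[g] cc)
      (hh : cc -->[h] dd) (ii : dd -->[i] ee),
    (ff ◃◃ dlassociator gg hh ii) •• dlassociator ff (gg ;; hh) ii
      •• (dlassociator ff gg hh ▹▹ ii)
    =2[ lassociator_lassociator f g h i ]
    dlassociator ff gg (hh ;; ii) •• dlassociator (ff ;; gg) hh ii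
}.

Lemma sigT_path (X : Type) (P : X -> Type) (u v : {x : X & P x})
  (p : projT1 u = projT1 v) : path_over p (projT2 u) (projT2 v) -> u = v.
Proof.
  destruct u as [x s], v as [y t]; cbn in *.
  destruct p; intros []. reflexivity.
Defined.

Lemma sigT_hset (X : Type) (P : X -> Type) :
  IsHSet X -> (forall x : X, IsHSet (P x)) -> IsHSet {x : X & P x}.
Proof.
  intros HX HP u v.
  assert (E : forall p : u = v, p = sigT_path (projT2_eq p)).
  { intros []. destruct u. reflexivity. }
  intros p q. rewrite (E p), (E q).
  generalize (projT2_eq p), (projT2_eq q).
  rewrite (HX _ _ (projT1_eq p) (projT1_eq q)).
  intros s t. rewrite (HP _ _ _ s t). reflexivity.
Qed.

Section Total.
Variables (B : bicat) (D : disp_bicat B).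

Definition total_bicat_data : bicat_data :=
  {| ob := {a : B & D a};
     hom := fun a b => {f : projT1 a --> projT1 b & projT2 a -->[f] projT2 b};
     cell := fun a b f g =>
       {x : projT1 f ==> projT1 g & projT2 f ==>[x] projT2 g};
     id1 := fun a => existT _ (id1 (projT1 a)) (did1 (projT2 a));
     comp := fun a b c f g =>
       existT _ (projT1 f · projT1 g) (projT2 f ;; projT2 g);
     id2 := fun a b f => existT _ (id2 (projT1 f)) (did2 (projT2 f));
     vcomp := fun a b f g h x y =>
       existT _ (projT1 x • projT1 y) (projT2 x •• projT2 y);
     lwhisker := fun a b c f g h x =>
       existT _ (projT1 f ◃ projT1 x) (projT2 f ◃◃ projT2 x);
     rwhisker := fun a b c f g h x =>
       existT _ (projT1 x ▹ projT1 h) (projT2 x ▹▹ projT2 h);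
     lunitor := fun a b f =>
       existT _ (lunitor (projT1 f)) (dlunitor (projT2 f));
     linvunitor := fun a b f =>
       existT _ (linvunitor (projT1 f)) (dlinvunitor (projT2 f));
     runitor := fun a b f =>
       existT _ (runitor (projT1 f)) (drunitor (projT2 f));
     rinvunitor := fun a b f =>
       existT _ (rinvunitor (projT1 f)) (drinvunitor (projT2 f));
     lassociator := fun a b c d f g h =>
       existT _ (lassociator (projT1 f) (projT1 g) (projT1 h))
         (dlassociator (projT2 f) (projT2 g) (projT2 h));
     rassociator := fun a b c d f g h =>
       existT _ (rassociator (projT1 f) (projT1 g) (projT1 h))
         (drassociator (projT2 f) (projT2 g) (projT2 h)) |}.

Definition total_bicat : bicat.
Proof.
  refine {| bicat_data_of := total_bicat_data |}.
  - abstract (intros; apply sigT_hset;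
      [apply cell_hset | intro; apply dcell_hset]).
  - abstract (intros; eapply sigT_path;
      exact (did2_left (projT2 x))).
  - abstract (intros; eapply sigT_path;
      exact (did2_right (projT2 x))).
  - abstract (intros;
      eapply sigT_path;
      exact (dvassocr (projT2 x) (projT2 y) (projT2 z))).
  - abstract (intros; eapply sigT_path;
      exact (dlwhisker_id2 (projT2 f) (projT2 g))).
  - abstract (intros; eapply sigT_path;
      exact (did2_rwhisker (projT2 f) (projT2 g))).
  - abstract (intros;
      eapply sigT_path;
      exact (dlwhisker_vcomp (projT2 f) (projT2 x) (projT2 y))).
  - abstract (intros;
      eapply sigT_path;
      exact (drwhisker_vcomp (projT2 i) (projT2 x) (projT2 y))).
  - abstract (intros; eapply sigT_path;
      exact (dvcomp_lunitor (projT2 x))).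
  - abstract (intros; eapply sigT_path;
      exact (dvcomp_runitor (projT2 x))).
  - abstract (intros;
      eapply sigT_path;
      exact (dlwhisker_lwhisker (projT2 f) (projT2 g) (projT2 x))).
  - abstract (intros;
      eapply sigT_path;
      exact (drwhisker_lwhisker (projT2 f) (projT2 i) (projT2 x))).
  - abstract (intros;
      eapply sigT_path;
      exact (drwhisker_rwhisker (projT2 h) (projT2 i) (projT2 x))).
  - abstract (intros; eapply sigT_path;
      exact (dvcomp_whisker (projT2 x) (projT2 y))).
  - abstract (intros; eapply sigT_path;
      exact (dlunitor_linvunitor (projT2 f))).
  - abstract (intros; eapply sigT_path;
      exact (dlinvunitor_lunitor (projT2 f))).
  - abstract (intros; eapply sigT_path;
      exact (drunitor_rinvunitor (projT2 f))).
  - abstract (intros; eapply sigT_path;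
      exact (drinvunitor_runitor (projT2 f))).
  - abstract (intros; eapply sigT_path;
      exact (dlassociator_rassociator (projT2 f) (projT2 g) (projT2 h))).
  - abstract (intros; eapply sigT_path;
      exact (drassociator_lassociator (projT2 f) (projT2 g) (projT2 h))).
  - abstract (intros;
      eapply sigT_path;
      exact (drunitor_rwhisker (projT2 f) (projT2 g))).
  - abstract (intros; eapply sigT_path;
      exact (dlassociator_lassociator (projT2 f) (projT2 g) (projT2 h) (projT2 i))).
Defined.

End Total.

Record disp_inv2cell (B : bicat) (D : disp_bicat B) (a b : B) (f g : a --> b)
  (x : inv2cell f g) (aa : D a) (bb : D b)
  (ff : aa -->[f] bb) (gg : aa -->[g] bb) : Type := {
  disp_inv2cell_cell :> ff ==>[x] gg;
  disp_inv2cell_inv : gg ==>[inv2cell_inv x] ff;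
  disp_inv2cell_rinv :
    disp_inv2cell_cell •• disp_inv2cell_inv =2[ inv2cell_rinv x ] did2 ff;
  disp_inv2cell_linv :
    disp_inv2cell_inv •• disp_inv2cell_cell =2[ inv2cell_linv x ] did2 gg
}.

Definition did2_disp_inv2cell (B : bicat) (D : disp_bicat B) (a b : B)
  (f : a --> b) (aa : D a) (bb : D b) (ff : aa -->[f] bb) :
  disp_inv2cell (id2_inv2cell f) ff ff :=
  Build_disp_inv2cell (x := id2_inv2cell f)
    (did2_left (did2 ff)) (did2_left (did2 ff)).

Definition dlunitor_disp_inv2cell (B : bicat) (D : disp_bicat B) (a b : B)
  (f : a --> b) (aa : D a) (bb : D b) (ff : aa -->[f] bb) :
  disp_inv2cell (lunitor_inv2cell f) (did1 aa ;; ff) ff :=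
  Build_disp_inv2cell (x := lunitor_inv2cell f)
    (dlunitor_linvunitor ff) (dlinvunitor_lunitor ff).

Definition dlinvunitor_disp_inv2cell (B : bicat) (D : disp_bicat B) (a b : B)
  (f : a --> b) (aa : D a) (bb : D b) (ff : aa -->[f] bb) :
  disp_inv2cell (linvunitor_inv2cell f) ff (did1 aa ;; ff) :=
  Build_disp_inv2cell (x := linvunitor_inv2cell f)
    (dlinvunitor_lunitor ff) (dlunitor_linvunitor ff).

Record disp_adj_equiv (B : bicat) (D : disp_bicat B) (a b : B)
  (f : adj_equiv a b) (aa : D a) (bb : D b) : Type := {
  disp_adj_equiv_hom :> aa -->[f] bb;
  disp_adj_equiv_radj : bb -->[adj_equiv_radj f] aa;
  disp_adj_equiv_unit :
    disp_inv2cell (adj_equiv_unit f)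
      (did1 aa) (disp_adj_equiv_hom ;; disp_adj_equiv_radj);
  disp_adj_equiv_counit :
    disp_inv2cell (adj_equiv_counit f)
      (disp_adj_equiv_radj ;; disp_adj_equiv_hom) (did1 bb);
  disp_adj_equiv_triangle1 :
    dlinvunitor disp_adj_equiv_hom
    •• (disp_adj_equiv_unit ▹▹ disp_adj_equiv_hom)
    •• drassociator disp_adj_equiv_hom disp_adj_equiv_radj disp_adj_equiv_hom
    •• (disp_adj_equiv_hom ◃◃ disp_adj_equiv_counit)
    •• drunitor disp_adj_equiv_hom
    =2[ adj_equiv_triangle1 f ] did2 disp_adj_equiv_hom;
  disp_adj_equiv_triangle2 :
    drinvunitor disp_adj_equiv_radj
    •• (disp_adj_equiv_radj ◃◃ disp_adj_equiv_unit)
    •• dlassociator disp_adj_equiv_radj disp_adj_equiv_hom disp_adj_equiv_radj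
    •• (disp_adj_equiv_counit ▹▹ disp_adj_equiv_radj)
    •• dlunitor disp_adj_equiv_radj
    =2[ adj_equiv_triangle2 f ] did2 disp_adj_equiv_radj
}.

(** A displayed equation holds as soon as the corresponding equation holds in
    the total bicategory, since 2-cells of the base form sets. *)
Lemma dcell_over_total (B : bicat) (D : disp_bicat B) (a b : B)
  (f g : a --> b) (aa : D a) (bb : D b) (ff : aa -->[f] bb) (gg : aa -->[g] bb)
  (x y : f ==> g) (p : x = y) (xx : ff ==>[x] gg) (yy : ff ==>[y] gg) :
  existT (fun z : f ==> g => ff ==>[z] gg) x xx = existT _ y yy ->
  xx =2[ p ] yy.
Proof.
  intro e.
  rewrite (cell_hset p (projT1_eq e)).
  exact (projT2_eq e).
Qed.

Lemma did1_triangle1 (B : bicat) (D : disp_bicat B) (a : B) (aa : D a) :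
  dlinvunitor (did1 aa)
  •• (dlinvunitor (did1 aa) ▹▹ did1 aa)
  •• drassociator (did1 aa) (did1 aa) (did1 aa)
  •• (did1 aa ◃◃ dlunitor (did1 aa))
  •• drunitor (did1 aa)
  =2[ id1_triangle1 a ] did2 (did1 aa).
Proof.
  apply dcell_over_total.
  exact (@id1_triangle1 (total_bicat D) (existT _ a aa)).
Qed.

Lemma did1_triangle2 (B : bicat) (D : disp_bicat B) (a : B) (aa : D a) :
  drinvunitor (did1 aa)
  •• (did1 aa ◃◃ dlinvunitor (did1 aa))
  •• dlassociator (did1 aa) (did1 aa) (did1 aa)
  •• (dlunitor (did1 aa) ▹▹ did1 aa)
  •• dlunitor (did1 aa)
  =2[ id1_triangle2 a ] did2 (did1 aa).
Proof.
  apply dcell_over_total.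
  exact (@id1_triangle2 (total_bicat D) (existT _ a aa)).
Qed.

Definition did1_disp_adj_equiv (B : bicat) (D : disp_bicat B) (a : B)
  (aa : D a) : disp_adj_equiv (id1_adj_equiv a) aa aa :=
  Build_disp_adj_equiv (f := id1_adj_equiv a)
    (disp_adj_equiv_unit := dlinvunitor_disp_inv2cell (did1 aa))
    (disp_adj_equiv_counit := dlunitor_disp_inv2cell (did1 aa))
    (did1_triangle1 aa) (did1_triangle2 aa).

Definition disp_idtoiso_2_1 (B : bicat) (D : disp_bicat B) (a b : B)
  (f g : a --> b) (p : f = g) (aa : D a) (bb : D b)
  (ff : aa -->[f] bb) (gg : aa -->[g] bb) :
  path_over (P := fun h : a --> b => aa -->[h] bb) p ff gg ->
  disp_inv2cell (idtoiso_2_1 p) ff gg :=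
  match p as p0 in _ = h return
    forall hh : aa -->[h] bb,
      path_over (P := fun h : a --> b => aa -->[h] bb) p0 ff hh ->
      disp_inv2cell (idtoiso_2_1 p0) ff hh
  with
  | eq_refl => fun hh q =>
      match q in _ = hh0 return disp_inv2cell (id2_inv2cell f) ff hh0 with
      | eq_refl => did2_disp_inv2cell ff
      end
  end gg.

Definition disp_idtoiso_2_0 (B : bicat) (D : disp_bicat B) (a b : B)
  (p : a = b) (aa : D a) (bb : D b) :
  path_over (P := fun c : B => D c) p aa bb ->
  disp_adj_equiv (idtoiso_2_0 p) aa bb :=
  match p as p0 in _ = c return
    forall cc : D c,
      path_over (P := fun c : B => D c) p0 aa cc ->
      disp_adj_equiv (idtoiso_2_0 p0) aa cc
  with
  | eq_refl => fun cc q =>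
      match q in _ = cc0 return disp_adj_equiv (id1_adj_equiv a) aa cc0 with
      | eq_refl => did1_disp_adj_equiv aa
      end
  end bb.

Definition disp_locally_univalent (B : bicat) (D : disp_bicat B) : Type :=
  forall (a b : B) (f g : a --> b) (p : f = g) (aa : D a) (bb : D b)
    (ff : aa -->[f] bb) (gg : aa -->[g] bb),
    is_equiv (@disp_idtoiso_2_1 B D a b f g p aa bb ff gg).

Definition disp_globally_univalent (B : bicat) (D : disp_bicat B) : Type :=
  forall (a b : B) (p : a = b) (aa : D a) (bb : D b),
    is_equiv (@disp_idtoiso_2_0 B D a b p aa bb).

(* Main.v *)
Require Import Defs.

(** By the fundamental theorem of identity types, a family of maps
    [u = v -> R v] consists of equivalences exactly when [{v & R v}] is
    contractible.  Hence univalence says that invertible 2-cells out of a fixed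
    1-cell, respectively adjoint equivalences out of a fixed object, form a
    contractible type, and displayed univalence, used only over [eq_refl], says
    the same of the displayed ones lying over an identity.  An invertible 2-cell
    or adjoint equivalence of the total bicategory amounts to one of the base
    together with a displayed one over it, and a sum of contractible types over
    a contractible type is contractible. *)

Set Implicit Arguments.
Unset Strict Implicit.

Lemma is_contr_retract (X Y : Type) (s : X -> Y) (r : Y -> X) :
  (forall x : X, r (s x) = x) -> is_contr Y -> is_contr X.
Proof.
  intros rs [c Hc]. exists (r c). intro x.
  rewrite <- (rs x), (Hc (s x)). reflexivity.
Qed.

Lemma is_contr_path (X : Type) (x y : X) : is_contr X -> is_contr (x = y).
Proof.
  intros [c Hc].
  exists (eq_trans (Hc x) (eq_sym (Hc y))).
  intros []. destruct (Hc x). reflexivity.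
Qed.

Lemma is_contr_singleton (X : Type) (u : X) : is_contr {v : X & u = v}.
Proof. exists (existT _ u eq_refl). intros [v []]. reflexivity. Qed.

(** All points of a contractible base are equal, so one contractible fiber gives them all; [x0] can
    thus be chosen as the point whose fiber is known. *)
Lemma is_contr_sigT (X : Type) (P : X -> Type) (x0 : X) :
  is_contr X -> is_contr (P x0) -> is_contr {x : X & P x}.
Proof.
  intros [c Hc] HP.
  assert (HPc : is_contr (P c)) by (rewrite <- (Hc x0); exact HP).
  destruct HPc as [d Hd].
  exists (existT _ c d). intros [x y].
  destruct (eq_sym (Hc x)). rewrite (Hd y). reflexivity.
Qed.

Section IdentityTypes.
Variables (X : Type) (u : X) (R : X -> Type) (phi : forall v : X, u = v -> R v).

(** Fiberwise inverses of [phi] make the sum a retract of the singleton [{v : X & u = v}]. *)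
Lemma is_contr_total_of_is_equiv :
  (forall v : X, is_equiv (@phi v)) -> is_contr {v : X & R v}.
Proof.
  intro H.
  apply (@is_contr_retract _ {v : X & u = v}
    (fun w => existT _ (projT1 w) (projT1 (projT1 (H (projT1 w) (projT2 w)))))
    (fun w => existT _ (projT1 w) (phi (projT2 w)))).
  - intros [v y]. cbn.
    rewrite (projT2 (projT1 (H v y))). reflexivity.
  - apply is_contr_singleton.
Qed.

(* The fiber of [phi v] over [y] is the type of paths in [{v & R v}] from
   [(u, phi u eq_refl)] to [(v, y)]. *)
Lemma is_equiv_of_is_contr_total :
  is_contr {v : X & R v} -> forall v : X, is_equiv (@phi v).
Proof.
  intros H v y.
  pose (base := existT R u (phi eq_refl)).
  (* Path induction requires a free endpoint, so [r] is defined for all [w] and used at the pair of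
     [v] and [y]. *)
  pose (r := fun (w : {v : X & R v}) (e : base = w) =>
    match e in _ = w' return {p : u = projT1 w' & phi p = projT2 w'} with
    | eq_refl => existT (fun p : u = u => phi p = phi eq_refl) eq_refl eq_refl
    end).
  apply (@is_contr_retract _ (base = existT R v y)
    (fun a => match projT2 a in _ = y' return base = existT R v y' with
      | eq_refl =>
          match projT1 a as p in _ = v' return base = existT R v' (phi p) with
          | eq_refl => eq_refl
          end
      end)
    (r (existT R v y))).
  - intros [p q]. cbn in p, q. destruct p, q. reflexivity.
  - apply is_contr_path, H.
Qed.

End IdentityTypes.

Lemma inv2cell_path (B : bicat) (a b : B) (f g : a --> b) (x y : inv2cell f g) :
  inv2cell_cell x = inv2cell_cell y -> inv2cell_inv x = inv2cell_inv y -> x = y.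
Proof.
  destruct x as [x x' p q], y as [y y' p' q']. cbn.
  intros e e'. destruct e, e'.
  rewrite (cell_hset p p'), (cell_hset q q'). reflexivity.
Qed.

(** Both sides share [f] and [r], so units and counits are compared without transport; the triangle
    identities are equations in sets. *)
Lemma adj_equiv_path (B : bicat) (a b : B) (f : a --> b) (r : b --> a)
  (eta eta' : inv2cell (id1 a) (f · r)) (eps eps' : inv2cell (r · f) (id1 b))
  t1 t2 t1' t2' :
  eta = eta' -> eps = eps' ->
  @Build_adj_equiv B a b f r eta eps t1 t2 =
  @Build_adj_equiv B a b f r eta' eps' t1' t2'.
Proof.
  intros p q. destruct p, q.
  rewrite (cell_hset t1 t1'), (cell_hset t2 t2'). reflexivity.
Qed.

(** Converse of [dcell_over_total]: it turns displayed laws into laws of the total bicategory. *)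
Lemma total_of_dcell_over (B : bicat) (D : disp_bicat B) (a b : B)
  (f g : a --> b) (aa : D a) (bb : D b) (ff : aa -->[f] bb) (gg : aa -->[g] bb)
  (x y : f ==> g) (p : x = y) (xx : ff ==>[x] gg) (yy : ff ==>[y] gg) :
  xx =2[ p ] yy ->
  existT (fun z : f ==> g => ff ==>[z] gg) x xx = existT _ y yy.
Proof.
  intro q. destruct p, q. reflexivity.
Qed.

Section TotalCells.
Variables (B : bicat) (D : disp_bicat B).

Definition total_inv2cell (a b : total_bicat D) (f g : a --> b)
  (x : inv2cell (projT1 f) (projT1 g))
  (xx : disp_inv2cell x (projT2 f) (projT2 g)) : inv2cell f g :=
  Build_inv2cell (B := total_bicat D) (f := f) (g := g)
    (inv2cell_cell := existT _ (inv2cell_cell x) (disp_inv2cell_cell xx))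
    (inv2cell_inv := existT _ (inv2cell_inv x) (disp_inv2cell_inv xx))
    (total_of_dcell_over (disp_inv2cell_rinv xx))
    (total_of_dcell_over (disp_inv2cell_linv xx)).

Definition base_inv2cell (a b : total_bicat D) (f g : a --> b)
  (x : inv2cell f g) : inv2cell (projT1 f) (projT1 g) :=
  {| inv2cell_cell := projT1 (inv2cell_cell x);
     inv2cell_inv := projT1 (inv2cell_inv x);
     inv2cell_rinv := projT1_eq (inv2cell_rinv x);
     inv2cell_linv := projT1_eq (inv2cell_linv x) |}.

(** The laws of [base_inv2cell] are given by [projT1_eq], so [projT2_eq] lies over exactly these
    paths. *)
Definition fiber_inv2cell (a b : total_bicat D) (f g : a --> b)
  (x : inv2cell f g) :
  disp_inv2cell (base_inv2cell x) (projT2 f) (projT2 g) :=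
  Build_disp_inv2cell (x := base_inv2cell x)
    (disp_inv2cell_cell := projT2 (inv2cell_cell x))
    (disp_inv2cell_inv := projT2 (inv2cell_inv x))
    (projT2_eq (inv2cell_rinv x))
    (projT2_eq (inv2cell_linv x)).

Lemma total_fiber_inv2cell (a b : total_bicat D) (f g : a --> b)
  (x : inv2cell f g) : total_inv2cell (fiber_inv2cell x) = x.
Proof.
  apply inv2cell_path; symmetry; apply sigT_eta.
Qed.

Definition total_adj_equiv (a b : total_bicat D)
  (f : adj_equiv (projT1 a) (projT1 b))
  (ff : disp_adj_equiv f (projT2 a) (projT2 b)) : adj_equiv a b :=
  Build_adj_equiv (B := total_bicat D) (a := a) (b := b)
    (adj_equiv_hom := existT _ (adj_equiv_hom f) (disp_adj_equiv_hom ff))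
    (adj_equiv_radj := existT _ (adj_equiv_radj f) (disp_adj_equiv_radj ff))
    (adj_equiv_unit := total_inv2cell
      (f := existT _ _ _) (g := existT _ _ _) (disp_adj_equiv_unit ff))
    (adj_equiv_counit := total_inv2cell
      (f := existT _ _ _) (g := existT _ _ _) (disp_adj_equiv_counit ff))
    (total_of_dcell_over (disp_adj_equiv_triangle1 ff))
    (total_of_dcell_over (disp_adj_equiv_triangle2 ff)).

Definition base_adj_equiv (a b : total_bicat D) (f : adj_equiv a b) :
  adj_equiv (projT1 a) (projT1 b) :=
  Build_adj_equiv
    (adj_equiv_hom := projT1 (adj_equiv_hom f))
    (adj_equiv_radj := projT1 (adj_equiv_radj f))
    (adj_equiv_unit := base_inv2cell (adj_equiv_unit f))
    (adj_equiv_counit := base_inv2cell (adj_equiv_counit f))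
    (projT1_eq (adj_equiv_triangle1 f))
    (projT1_eq (adj_equiv_triangle2 f)).

Definition fiber_adj_equiv (a b : total_bicat D) (f : adj_equiv a b) :
  disp_adj_equiv (base_adj_equiv f) (projT2 a) (projT2 b) :=
  Build_disp_adj_equiv (f := base_adj_equiv f)
    (disp_adj_equiv_hom := projT2 (adj_equiv_hom f))
    (disp_adj_equiv_radj := projT2 (adj_equiv_radj f))
    (disp_adj_equiv_unit := fiber_inv2cell (adj_equiv_unit f))
    (disp_adj_equiv_counit := fiber_inv2cell (adj_equiv_counit f))
    (projT2_eq (adj_equiv_triangle1 f))
    (projT2_eq (adj_equiv_triangle2 f)).

Lemma total_fiber_adj_equiv (a b : total_bicat D) (f : adj_equiv a b) :
  total_adj_equiv (fiber_adj_equiv f) = f.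
Proof.
  (* Once the 1-cells are literal pairs, the round trip returns them definitionally, and only unit
     and counit remain to be compared. *)
  destruct f as [[f ff] [r rr] eta eps t1 t2].
  apply adj_equiv_path; apply total_fiber_inv2cell.
Qed.

Lemma total_locally_univalent :
  locally_univalent B -> disp_locally_univalent D ->
  locally_univalent (total_bicat D).
Proof.
  intros HB HD a b f.
  apply is_equiv_of_is_contr_total.
  (* The sum is regrouped: the base 1-cell and its invertible 2-cell come first, and [Q] collects
     the displayed data over them. *)
  pose (Q := fun w : {g : projT1 a --> projT1 b & inv2cell (projT1 f) g} =>
    {gg : projT2 a -->[projT1 w] projT2 b &
      disp_inv2cell (projT2 w) (projT2 f) gg}).
  apply (@is_contr_retract _ {w : _ & Q w}
    (fun w => existT Q
       (existT _ (projT1 (projT1 w)) (base_inv2cell (projT2 w)))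
       (existT _ (projT2 (projT1 w)) (fiber_inv2cell (projT2 w))))
    (fun w => existT (fun g : a --> b => inv2cell f g)
       (existT _ (projT1 (projT1 w)) (projT1 (projT2 w)))
       (total_inv2cell (g := existT _ (projT1 (projT1 w)) (projT1 (projT2 w)))
         (projT2 (projT2 w))))).
  - intros [[g gg] x].
    exact (f_equal (existT _ _) (total_fiber_inv2cell x)).
  - apply (is_contr_sigT (x0 := existT _ (projT1 f) (id2_inv2cell (projT1 f)))).
    + exact (is_contr_total_of_is_equiv (HB _ _ (projT1 f))).
    (* Over [eq_refl], [path_over] computes to equality and [idtoiso_2_1] to [id2_inv2cell], so
       displayed univalence concerns maps out of an identity type. *)
    + exact (is_contr_total_of_is_equiv
        (HD _ _ _ _ (eq_refl (projT1 f)) _ _ (projT2 f))).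
Qed.

Lemma total_globally_univalent :
  globally_univalent B -> disp_globally_univalent D ->
  globally_univalent (total_bicat D).
Proof.
  intros HB HD a.
  apply is_equiv_of_is_contr_total.
  pose (Q := fun w : {b : B & adj_equiv (projT1 a) b} =>
    {bb : D (projT1 w) & disp_adj_equiv (projT2 w) (projT2 a) bb}).
  apply (@is_contr_retract _ {w : _ & Q w}
    (fun w => existT Q
       (existT _ (projT1 (projT1 w)) (base_adj_equiv (projT2 w)))
       (existT _ (projT2 (projT1 w)) (fiber_adj_equiv (projT2 w))))
    (fun w => existT (fun b : total_bicat D => adj_equiv a b)
       (existT _ (projT1 (projT1 w)) (projT1 (projT2 w)))
       (total_adj_equiv (b := existT _ (projT1 (projT1 w)) (projT1 (projT2 w)))
         (projT2 (projT2 w))))).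
  - intros [[b bb] f].
    exact (f_equal (existT _ _) (total_fiber_adj_equiv f)).
  (* The chosen point is [idtoiso_2_0] at [eq_refl], where the fiber is governed by displayed global
     univalence. *)
  - apply (is_contr_sigT (x0 := existT _ (projT1 a) (id1_adj_equiv (projT1 a)))).
    + exact (is_contr_total_of_is_equiv (HB (projT1 a))).
    + exact (is_contr_total_of_is_equiv (HD _ _ (eq_refl (projT1 a)) (projT2 a))).
Qed.

End TotalCells.

Theorem theorem7p4 (B : bicat) (D : disp_bicat B) :
  (locally_univalent B -> disp_locally_univalent D ->
   locally_univalent (total_bicat D)) *
  (globally_univalent B -> disp_globally_univalent D ->
   globally_univalent (total_bicat D)).
Proof.
  split.
  - apply total_locally_univalent.
  - apply total_globally_univalent.
Qed.
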